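(* Let $G = (V(G), E(G), \mathbf{s}, \mathbf{r})$ be a non-trivial directed graph. Then $\mathrm{diam}(\Gamma(I(G))) \in \{1, 2\}$.
   Context: A directed graph $G=(V(G),E(G),\mathbf{s},\mathbf{r})$ has a non-empty vertex set $V(G)$, an edge set $E(G)$ (loops and multiple edges allowed), and source and range maps $\mathbf{s},\mathbf{r}:E(G)\to V(G)$. It is trivial if it consists of one isolated vertex (one vertex, no edges); non-trivial otherwise. $\mathrm{Path}(G)$ is the set of all finite directed paths $p=e_1\cdots e_n$ (with $\mathbf{r}(e_i)=\mathbf{s}(e_{i+1})$, $\mathbf{s}(p)=\mathbf{s}(e_1)$, $\mathbf{r}(p)=\mathbf{r}(e_n)$), including each vertex $v$ as an empty path with $\mathbf{s}(v)=\mathbf{r}(v)=v$; $p^{-1}=e_n^{-1}\cdots e_1^{-1}$ and $v^{-1}=v$. The graph inverse semigroup $I(G)$ is the semigroup with zero generated by $V(G)\cup E(G)\cup\{e^{-1}:e\in E(G)\}$ subject to, for $u,v\in V(G)$, $e,f\in E(G)$: $uv=\delta_{u,v}u$; $\mathbf{s}(e)e=e\mathbf{r}(e)=e$; $\mathbf{r}(e)e^{-1}=e^{-1}\mathbf{s}(e)=e^{-1}$; $e^{-1}f=\delta_{e,f}\mathbf{r}(e)$. Every non-zero element is uniquely $pq^{-1}$ with $p,q\in\mathrm{Path}(G)$, $\mathbf{r}(p)=\mathbf{r}(q)$; $(pq^{-1})(rs^{-1})$ equals $pts^{-1}$ if $r=qt$, $p(st)^{-1}$ if $q=rt$ (for a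 possibly empty path $t$), and $0$ otherwise. $I(G)$ is an inverse semigroup with idempotents $pp^{-1}$ ($p\in\mathrm{Path}(G)$) and $0$. For an inverse semigroup $T$ with zero, the natural partial order is $a\le b$ iff $a=eb$ for some idempotent $e$; $\omega(a,b)=\{c\in T:c\le a \text{ and } c\le b\}$. The zero-divisor graph $\Gamma(T)$ is the simple undirected graph with vertex set $Z(T)^\times=\{a\in T\setminus\{0\}:\exists\,b\in T\setminus\{0\},\ \omega(a,b)=\{0\}\}$, where distinct vertices $a,b$ are adjacent iff $\omega(a,b)=\{0\}$. The distance between two distinct vertices is the length of a shortest path joining them ($\infty$ if there is none), and $\mathrm{diam}$ is the largest distance between pairs of distinct vertices. *)

(* Defs.v *)
From HB Require Import structures.
From mathcomp Require Import all_boot.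
From mathcomp Require Import boolp classical_sets.

Set Implicit Arguments.
Unset Strict Implicit.
Unset Printing Implicit Defensive.

Local Open Scope classical_set_scope.
Local Open Scope quotient_scope.

(* Vertices and edges form arbitrary, possibly infinite, types. *)
Record digraph := Digraph {
  vertex : Type;
  edge : Type;
  source : edge -> vertex;
  range : edge -> vertex;
  vertex_inhabited : inhabited vertex
}.

Definition trivial_digraph (G : digraph) : Prop :=
  (exists v : vertex G, forall u : vertex G, u = v) /\ (edge G -> False).

HB.mixin Record Semigroup_hasZero T of Semigroup T := {
  szero : T;
  mul_szero_l : left_zero szero (@mul T);
  mul_szero_r : right_zero szero (@mul T)
}.

#[short(type="semigroup0Type")]
HB.structure Definition Semigroup0 := {T of Semigroup T & Semigroup_hasZero T}.

Section GraphInverseSemigroup.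
Variable G : digraph.

(* Terms of the free magma with a constant for zero; the semigroup-with-zero
   laws are imposed by the congruence [igs_eq], together with the relations. *)
Inductive igs_term : Type :=
| Zero
| Vert of vertex G
| Edge of edge G
| EdgeV of edge G
| Mul of igs_term & igs_term.

HB.instance Definition _ := gen_eqMixin igs_term.
HB.instance Definition _ := gen_choiceMixin igs_term.

Inductive igs_eq : igs_term -> igs_term -> Prop :=
| igs_refl a : igs_eq a a
| igs_sym a b : igs_eq a b -> igs_eq b a
| igs_trans a b c : igs_eq a b -> igs_eq b c -> igs_eq a c
| igs_mul a a' b b' :
    igs_eq a a' -> igs_eq b b' -> igs_eq (Mul a b) (Mul a' b')
| igs_assoc a b c : igs_eq (Mul a (Mul b c)) (Mul (Mul a b) c)
| igs_zero_l a : igs_eq (Mul Zero a) Zero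
| igs_zero_r a : igs_eq (Mul a Zero) Zero
| igs_vert_eq v : igs_eq (Mul (Vert v) (Vert v)) (Vert v)
| igs_vert_neq u v : u <> v -> igs_eq (Mul (Vert u) (Vert v)) Zero
| igs_source_edge e : igs_eq (Mul (Vert (source e)) (Edge e)) (Edge e)
| igs_edge_range e : igs_eq (Mul (Edge e) (Vert (range e))) (Edge e)
| igs_range_edgeV e : igs_eq (Mul (Vert (range e)) (EdgeV e)) (EdgeV e)
| igs_edgeV_source e : igs_eq (Mul (EdgeV e) (Vert (source e))) (EdgeV e)
| igs_edgeV_edge_eq e : igs_eq (Mul (EdgeV e) (Edge e)) (Vert (range e))
| igs_edgeV_edge_neq e f : e <> f -> igs_eq (Mul (EdgeV e) (Edge f)) Zero.

Definition igs_eqb : rel igs_term := fun a b => `[< igs_eq a b >].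

Lemma igs_eqb_refl : reflexive igs_eqb.
Proof. by move=> a; apply/asboolP; exact: igs_refl. Qed.

Lemma igs_eqb_sym : symmetric igs_eqb.
Proof. by move=> a b; apply/asboolP/asboolP; exact: igs_sym. Qed.

Lemma igs_eqb_trans : transitive igs_eqb.
Proof.
move=> b a c /asboolP ab /asboolP bc; apply/asboolP; exact: igs_trans ab bc.
Qed.

Canonical igs_equiv := EquivRel igs_eqb igs_eqb_refl igs_eqb_sym igs_eqb_trans.

Definition igs : Type := {eq_quot igs_equiv}.

HB.instance Definition _ := Choice.on igs.

Definition igs_class (a : igs_term) : igs := \pi_{eq_quot igs_equiv} a.

Definition igs_repr (x : igs) : igs_term := repr (x : {eq_quot igs_equiv}).

Definition igs_prod (x y : igs) : igs :=
  igs_class (Mul (igs_repr x) (igs_repr y)).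

Lemma igs_classP a b : igs_class a = igs_class b <-> igs_eq a b.
Proof.
split=> [/eqquotP /asboolP //|ab].
by apply/eqquotP; apply/asboolP.
Qed.

Lemma igs_reprK x : igs_class (igs_repr x) = x.
Proof. exact: reprK. Qed.

Lemma igs_prodE a b :
  igs_prod (igs_class a) (igs_class b) = igs_class (Mul a b).
Proof. by apply/igs_classP; apply: igs_mul; apply/igs_classP/igs_reprK. Qed.

Lemma igs_prodA : associative igs_prod.
Proof.
move=> x y z; rewrite -(igs_reprK x) -(igs_reprK y) -(igs_reprK z).
by rewrite !igs_prodE; apply/igs_classP/igs_assoc.
Qed.

HB.instance Definition _ := isSemigroup.Build igs igs_prodA.

Lemma igs_prod0l : left_zero (igs_class Zero) igs_prod.
Proof.
move=> x; rewrite -(igs_reprK x) igs_prodE.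
by apply/igs_classP/igs_zero_l.
Qed.

Lemma igs_prod0r : right_zero (igs_class Zero) igs_prod.
Proof.
move=> x; rewrite -(igs_reprK x) igs_prodE.
by apply/igs_classP/igs_zero_r.
Qed.

HB.instance Definition _ := Semigroup_hasZero.Build igs igs_prod0l igs_prod0r.

End GraphInverseSemigroup.

Record sgraph := SGraph {
  node : choiceType;
  adj : rel node;
  adj_sym : symmetric adj;
  adj_irrefl : irreflexive adj
}.

Section Distance.
Variable H : sgraph.

(* The path has vertices [x :: p], hence length [size p]. *)
Definition is_upath (x y : node H) (p : seq (node H)) : bool :=
  [&& path (@adj H) x p, last x p == y & uniq (x :: p)].

Definition has_upath (x y : node H) : pred nat :=
  fun n => `[< exists2 p, is_upath x y p & size p = n >].

(* [None] stands for an infinite distance. *)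
Definition distance (x y : node H) : option nat :=
  if pselect (exists n, has_upath x y n) is left h then Some (ex_minn h)
  else None.

Definition leq_inf (m n : option nat) : bool :=
  match m, n with
  | _, None => true
  | None, Some _ => false
  | Some m, Some n => m <= n
  end.

(* No [d] qualifies when there is no pair of distinct vertices. *)
Definition is_diam (d : option nat) : Prop :=
  (exists x y : node H, x <> y /\ distance x y = d) /\
  (forall x y : node H, x <> y -> leq_inf (distance x y) d).

End Distance.

(* These notions only involve the product and the zero of an inverse semigroup,
   so they are given for any semigroup with zero. *)
Section ZeroDivisorGraph.
Variable T : semigroup0Type.

Definition idempotent_elt (e : T) : Prop := mul e e = e.

Definition natural_le (a b : T) : Prop :=
  exists2 e, idempotent_elt e & a = mul e b.

Definition omega (a b : T) : set T := [set c | natural_le c a /\ natural_le c b].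

Definition zero_divisors : set T :=
  [set a | a <> szero /\ exists b, b <> szero /\ omega a b = [set szero]].

Definition zdg_adj : rel zero_divisors :=
  fun a b => `[< a <> b /\ omega (val a) (val b) = [set szero] >].

Lemma omegaC a b : omega a b = omega b a.
Proof. by apply/seteqP; split=> c []. Qed.

Lemma zdg_adj_sym : symmetric zdg_adj.
Proof.
by move=> a b; apply/asboolP/asboolP => -[/nesym ab]; rewrite omegaC.
Qed.

Lemma zdg_adj_irrefl : irreflexive zdg_adj.
Proof. by move=> a; apply/asboolP => -[]. Qed.

Definition zero_divisor_graph : sgraph := SGraph zdg_adj_sym zdg_adj_irrefl.

End ZeroDivisorGraph.

(* Main.v *)
(* The elements of I(G) act by partial injections on pairs (w, l) of a vertex
   and a list of edges: the normal form p q^-1 sends q l to p l.  This action is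
   faithful, and a <= b means that the action of b extends that of a.  If the
   actions of p q^-1 and r s^-1 agree at one point, then q l = s l' and
   p l = r l', so that cancelling the shorter of l and l' makes the two elements
   comparable.  Hence two vertices of the graph are adjacent exactly when they
   are incomparable; and if a < b, any neighbour of b is a neighbour of a.
   Finally, distinct vertices of G are adjacent, and so are e and s(e) for any
   edge e. *)
From mathcomp Require Import all_boot.
From mathcomp Require Import boolp classical_sets.
Require Import Defs.

Set Implicit Arguments.
Unset Strict Implicit.
Unset Printing Implicit Defensive.

(** * Graphs in which non-adjacent vertices have a common neighbour *)

Section Diameter.
Variable H : sgraph.

Lemma distance_adj (x y : node H) : adj x y -> distance x y = Some 1.
Proof.
move=> xy; have xNy : x != y by apply: contraTneq xy => ->; rewrite adj_irrefl.
have P1 : has_upath x y 1.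
  apply/asboolP; exists [:: y] => //.
  by rewrite /is_upath /= xy eqxx inE xNy.
rewrite /distance; case: pselect => [h|[]]; last by exists 1.
congr Some; case: ex_minnP => -[|n] /asboolP[p pP sp] /(_ _ P1).
  by case: p pP sp => //= /and3P[_ /eqP/= xy' _]; rewrite xy' eqxx in xNy.
by case: n sp.
Qed.

Lemma distance_common_neighbour (x y z : node H) :
  x <> y -> ~~ adj x y -> adj x z -> adj z y -> distance x y = Some 2.
Proof.
move=> /eqP xNy xy xz zy.
have xNz : x != z by apply: contraTneq xz => ->; rewrite adj_irrefl.
have zNy : z != y by apply: contraTneq zy => ->; rewrite adj_irrefl.
have P2 : has_upath x y 2.
  apply/asboolP; exists [:: z; y] => //.
  by rewrite /is_upath /= xz zy eqxx !inE negb_or xNz xNy zNy.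
rewrite /distance; case: pselect => [h|[]]; last by exists 2.
congr Some; case: ex_minnP => n /asboolP[p pP sp] /(_ _ P2).
(* Minimality leaves [n <= 2]; length 0 would force [x = y], and length 1 would make [x] and [y]
   adjacent. *)
case: n sp => [|[|[|n]]] //.
  by case: p pP => //= /and3P[_ /eqP/= xy' _]; rewrite xy' eqxx in xNy.
case: p pP => [|u [|? ?]] //= /and3P[/= /andP[xu _] /eqP uy _].
by rewrite -uy xu in xy.
Qed.

(** The value is 2 as soon as some distinct pair is non-adjacent, and 1 otherwise; the first
    hypothesis supplies a pair at which 1 is attained. *)
Lemma diam_common_neighbour :
  (exists x y : node H, x <> y) ->
  (forall x y : node H, x <> y -> ~~ adj x y ->
     exists2 z, adj x z & adj z y) ->
  exists2 d : nat, d = 1 \/ d = 2 & is_diam H (Some d).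
Proof.
move=> [x0 [y0 xy0]] common.
have [[x [y [xy nadj]]]|allN] :=
  pselect (exists x y : node H, x <> y /\ ~~ adj x y).
- exists 2; first by right.
  split=> [|u v uv].
    exists x, y; split=> //; have [z xz zy] := common _ _ xy nadj.
    exact: distance_common_neighbour xz zy.
  have [/distance_adj -> //|nuv] := boolP (adj u v).
  have [z uz zv] := common _ _ uv nuv.
  by rewrite (distance_common_neighbour uv nuv uz zv).
- have all_adj (u v : node H) : u <> v -> adj u v.
    by move=> uv; apply/negPn/negP => nuv; apply: allN; exists u, v.
  exists 1; first by left.
  split=> [|u v /all_adj/distance_adj -> //].
  by exists x0, y0; split=> //; exact/distance_adj/all_adj.
Qed.

End Diameter.

(** The piece appended to [r'] depends on the tails [k] and [k'] only, so two equations with the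
    same tails yield the same piece. This is what [act_tree] needs. *)
Lemma cat_eq_prefix T (r r' k k' : seq T) : size k <= size k' ->
  r ++ k = r' ++ k' -> r = r' ++ take (size k' - size k) k'.
Proof.
move=> kk' rk; have -> : r = take (size (r ++ k) - size k) (r ++ k).
  by rewrite size_cat addnK take_size_cat.
by rewrite rk size_cat -addnBA // take_cat ltnNge leq_addr addKn.
Qed.

(** * The action by partial injections *)

Section Action.
Variable G : digraph.

Local Notation point := (vertex G * seq (edge G))%type.
Implicit Types (t a b c : igs_term G) (x y z : point).
Implicit Types (u v w : vertex G) (p q l : seq (edge G)).

(* [l] need not be a path starting at the vertex [x.1]: such junk points are
   carried along unchanged and harm neither the relations nor faithfulness. *)
Fixpoint act t x y : Prop :=
  match t with
  | Zero => False
  | Vert v => x.1 = v /\ y = x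
  | Edge e => x.1 = range e /\ y = (source e, e :: x.2)
  | EdgeV e => y.1 = range e /\ x = (source e, e :: y.2)
  | Mul a b => exists2 z, act b x z & act a z y
  end.

Fixpoint term_inv t : igs_term G :=
  match t with
  | Zero => Zero G
  | Vert v => Vert v
  | Edge e => EdgeV e
  | EdgeV e => Edge e
  | Mul a b => Mul (term_inv b) (term_inv a)
  end.

Lemma act_inv t x y : act (term_inv t) x y <-> act t y x.
Proof.
elim: t x y => //= [v|a IHa b IHb] x y.
  by split=> -[? ->].
by split=> -[z] => [/IHa ? /IHb ?|/IHb ? /IHa ?]; exists z.
Qed.

Lemma act_functional t x y z : act t x y -> act t x z -> y = z.
Proof.
elim: t x y z => //= [v|e|e|a IHa b IHb] x y z.
- by move=> [_ ->] [_ ->].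
- by move=> [_ ->] [_ ->].
- by case: y z => [? ?] [? ?] /= [-> ->] [-> [->]].
- move=> [y' by' ay] [z' bz az]; move: az.
  by rewrite -(IHb _ _ _ by' bz); exact: IHa.
Qed.

Lemma act_injective t x y z : act t x z -> act t y z -> x = y.
Proof. by move=> /act_inv xz /act_inv yz; exact: act_functional xz yz. Qed.

Lemma act_igs_eq a b : igs_eq a b -> forall x y, act a x y <-> act b x y.
Proof.
elim=> {a b} //.
- by move=> a b _ IH x y; split=> /IH.
- by move=> a b c _ IH1 _ IH2 x y; rewrite IH1.
- move=> a a' b b' _ IHa _ IHb x y /=.
  by split=> -[z /IHb ? /IHa ?]; exists z.
- move=> a b c x y /=; split.
    by move=> [z [z' ? ?] ?]; exists z' => //; exists z.
  by move=> [z ? [z' ? ?]]; exists z' => //; exists z.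
- by move=> a x y; split=> // -[].
- by move=> a x y; split=> // -[].
- move=> v x y /=; split=> [[z [? ->] //]|[? ->]].
  by exists x.
- move=> u v uv x y /=; split=> // -[z [xv ->] [xu _]].
  by apply: uv; rewrite -xu.
- move=> e x y /=; split=> [[z [? ->] [_ ->]] //|[? ->]].
  by exists (source e, e :: x.2).
- move=> e x y /=; split=> [[z [? ->] [_ ->]] //|[? ->]].
  by exists x.
- move=> e x y /=; split=> [[z [? ->] [? ->]] //|[? ->]].
  by exists y.
- move=> e x y /=; split=> [[z [? ->] [? ->]] //|[? ->]].
  by exists (source e, e :: y.2).
- move=> e [x1 x2] [y1 y2] /=; split.
    by move=> [z [-> ->] /= [-> [->]]].
  by move=> [-> [-> ->]]; exists (source e, e :: x2).
- move=> e f ef x y /=; split=> // -[z [_ ->] [_ [_ fe _]]].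
  exact: ef.
Qed.

(** * Normal forms and faithfulness *)

Fixpoint is_walk u p v : Prop :=
  if p is e :: p' then source e = u /\ is_walk (range e) p' v else u = v.

Lemma is_walk_end u p v w : is_walk u p v -> is_walk u p w -> v = w.
Proof.
elim: p u => [|e p IHp] u /=; first by move=> <-.
by move=> [_ pv] [_]; exact: IHp.
Qed.

(** The final [Vert v] turns the empty walk into a vertex; after a non-empty walk ending at [v] the
    last edge absorbs it. *)
Definition walk_term p v : igs_term G :=
  foldr (fun e => Mul (Edge e)) (Vert v) p.

Lemma act_walk_term u p v x y : is_walk u p v ->
  act (walk_term p v) x y <-> x.1 = v /\ y = (u, p ++ x.2).
Proof.
elim: p u y => [|e p IHp] u y /=.
  by move=> ->; case: x => x1 x2 /=; split=> -[-> ->].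
move=> [<- pv]; split.
  by move=> [z /(IHp _ _ pv)[-> ->] /= [_ ->]].
by move=> [xv ->]; exists (range e, p ++ x.2) => //; apply/(IHp _ _ pv).
Qed.

Definition normal_form p q v : igs_term G :=
  Mul (walk_term p v) (term_inv (walk_term q v)).

Lemma act_normal_form u w p q v x y : is_walk u p v -> is_walk w q v ->
  act (normal_form p q v) x y <->
  exists l, x = (w, q ++ l) /\ y = (u, p ++ l).
Proof.
move=> pv qv; split.
  move=> [z /act_inv/(act_walk_term _ _ qv)[zv ->]].
  by move=> /(act_walk_term _ _ pv)[_ ->]; exists z.2.
move=> [l [-> ->]]; exists (v, l).
  by apply/act_inv/(act_walk_term _ _ qv).
by apply/(act_walk_term _ _ pv).
Qed.

Lemma igs_eq_mull c a b : igs_eq a b -> igs_eq (Mul c a) (Mul c b).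
Proof. by move=> ab; apply: igs_mul ab; exact: igs_refl. Qed.

Lemma igs_eq_mulr c a b : igs_eq a b -> igs_eq (Mul a c) (Mul b c).
Proof. by move=> ab; apply: (igs_mul ab); exact: igs_refl. Qed.

Lemma igs_eq_inv a b : igs_eq a b -> igs_eq (term_inv a) (term_inv b).
Proof.
elim=> {a b} /=; try by move=> *; constructor.
- by move=> a b c _ ab _; exact: igs_trans ab.
- by move=> a b c; exact/igs_sym/igs_assoc.
- by move=> u v uv; apply/igs_vert_neq/nesym.
- by move=> e f ef; apply/igs_edgeV_edge_neq/nesym.
Qed.

(** Inserting the local units [b] and [c] gives [a d = a (b c) d]. Distinct vertices [b] and [c]
    thus annihilate a product whose factors do not fit together. *)
Lemma igs_eq_mul_zero a b c d :
  igs_eq (Mul a b) a -> igs_eq (Mul c d) d -> igs_eq (Mul b c) (Zero G) ->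
  igs_eq (Mul a d) (Zero G).
Proof.
move=> ab cd bc.
apply: igs_trans (igs_mul (igs_sym ab) (igs_sym cd)) _.
apply: igs_trans (igs_sym (igs_assoc _ _ _)) _.
apply: igs_trans (igs_eq_mull _ (igs_assoc _ _ _)) _.
apply: igs_trans (igs_eq_mull _ (igs_eq_mulr _ bc)) _.
apply: igs_trans (igs_eq_mull _ (igs_zero_l _)) _.
exact: igs_zero_r.
Qed.

Lemma vert_walk_term u p v : is_walk u p v ->
  igs_eq (Mul (Vert u) (walk_term p v)) (walk_term p v).
Proof.
case: p => [|e p] /=; first by move=> ->; exact: igs_vert_eq.
move=> [<- _]; apply: igs_trans (igs_assoc _ _ _) _.
exact/igs_eq_mulr/igs_source_edge.
Qed.

(** [walk_term] grows at the front, whereas multiplying [q^-1] on the left by [e^-1] appends [e] at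
    the end of [q]. *)
Lemma walk_term_rcons u p e : is_walk u p (source e) ->
  igs_eq (Mul (walk_term p (source e)) (Edge e))
         (walk_term (rcons p e) (range e)).
Proof.
elim: p u => [|f p IHp] u /=.
  move=> _; apply: igs_trans (igs_source_edge _) _.
  exact/igs_sym/igs_edge_range.
move=> [_ /IHp pe]; apply: igs_trans (igs_sym (igs_assoc _ _ _)) _.
exact: igs_eq_mull.
Qed.

Lemma is_walk_rcons u p e :
  is_walk u p (source e) -> is_walk u (rcons p e) (range e).
Proof.
by elim: p u => [|f p IHp] u /=; [move=> -> | move=> [-> /IHp]].
Qed.

Definition has_normal_form t : Prop :=
  igs_eq t (Zero G) \/
  exists u w p q v,
    [/\ is_walk u p v, is_walk w q v & igs_eq t (normal_form p q v)].

Lemma has_normal_form_eq a b :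
  igs_eq a b -> has_normal_form b -> has_normal_form a.
Proof.
move=> ab [b0|[u [w [p [q [v [pv qv bE]]]]]]].
  by left; exact: igs_trans b0.
by right; exists u, w, p, q, v; split=> //; exact: igs_trans bE.
Qed.

(** By associativity only generators [a] matter. On [p q^-1], a vertex is absorbed, an edge
    lengthens [p], and an inverse edge shortens [p] or, if [p] is empty, lengthens [q]; a mismatch
    gives zero. *)
Lemma has_normal_form_mul a b :
  has_normal_form b -> has_normal_form (Mul a b).
Proof.
elim: a b => [|v|e|e|a1 IH1 a2 IH2] b.
- by move=> _; left; exact: igs_zero_l.
- move=> [b0|[u [w [p [q [v' [pv qv bE]]]]]]].
    by left; apply: igs_trans (igs_eq_mull _ b0) (igs_zero_r _).
  apply: has_normal_form_eq (igs_eq_mull _ bE) _.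
  apply: has_normal_form_eq (igs_assoc _ _ _) _.
  have [vu|vu] := pselect (v = u).
    right; exists u, w, p, q, v'; split=> //.
    by rewrite vu; exact/igs_eq_mulr/vert_walk_term.
  left; apply: igs_trans (igs_eq_mulr _ _) (igs_zero_l _).
  apply: igs_eq_mul_zero (igs_vert_eq _) (vert_walk_term pv) _.
  exact: igs_vert_neq.
- move=> [b0|[u [w [p [q [v' [pv qv bE]]]]]]].
    by left; apply: igs_trans (igs_eq_mull _ b0) (igs_zero_r _).
  apply: has_normal_form_eq (igs_eq_mull _ bE) _.
  apply: has_normal_form_eq (igs_assoc _ _ _) _.
  have [eu|eu] := pselect (range e = u).
    right; exists (source e), w, (e :: p), q, v'.
    by split=> //=; [rewrite eu | exact: igs_refl].
  left; apply: igs_trans (igs_eq_mulr _ _) (igs_zero_l _).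
  apply: igs_eq_mul_zero (igs_edge_range _) (vert_walk_term pv) _.
  exact: igs_vert_neq.
- move=> [b0|[u [w [p [q [v' [pv qv bE]]]]]]].
    by left; apply: igs_trans (igs_eq_mull _ b0) (igs_zero_r _).
  apply: has_normal_form_eq (igs_eq_mull _ bE) _.
  apply: has_normal_form_eq (igs_assoc _ _ _) _.
  have [eu|eu] := pselect (source e = u); last first.
    left; apply: igs_trans (igs_eq_mulr _ _) (igs_zero_l _).
    apply: igs_eq_mul_zero (igs_edgeV_source _) (vert_walk_term pv) _.
    exact: igs_vert_neq.
  (* With [p] empty, [e^-1 q^-1] is the inverse of the walk [q e]. *)
  case: p pv {bE} => [/= uv|f p /= [fu pv]].
    rewrite -uv -eu in qv *.
    right; exists (range e), w, [::], (rcons q e), (range e).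
    split=> //; first exact: is_walk_rcons.
    apply: igs_trans (igs_eq_mulr _ (igs_edgeV_source _)) _.
    have qe := igs_eq_inv (walk_term_rcons qv).
    apply: igs_trans (igs_eq_mull _ qe).
    apply: igs_trans (igs_sym (igs_assoc _ _ _)).
    exact/igs_eq_mulr/igs_sym/igs_range_edgeV.
  (* With [p] starting with [f], the factor [e^-1 f] is now exposed: it is a vertex or zero. *)
  apply: has_normal_form_eq (igs_eq_mulr _ (igs_assoc _ _ _)) _.
  have [ef|ef] := pselect (e = f).
    rewrite -ef in pv *.
    right; exists (range e), w, p, q, v'; split=> //.
    apply: igs_eq_mulr.
    apply: igs_trans (igs_eq_mulr _ (igs_edgeV_edge_eq _)) _.
    exact: vert_walk_term.
  left; apply: igs_trans (igs_eq_mulr _ _) (igs_zero_l _).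
  apply: igs_trans (igs_eq_mulr _ _) (igs_zero_l _).
  exact: igs_edgeV_edge_neq.
- move=> /IH2/IH1; apply: has_normal_form_eq.
  exact/igs_sym/igs_assoc.
Qed.

Lemma normal_formP t : has_normal_form t.
Proof.
have vertP v : has_normal_form (Vert v).
  right; exists v, v, [::], [::], v; split=> //.
  exact/igs_sym/igs_vert_eq.
elim: t => [|//|e|e|a _ b /has_normal_form_mul //].
- by left; exact: igs_refl.
(* A right factor that is a vertex, already in normal form, brings generators under the previous
   lemma. *)
- apply: has_normal_form_eq (igs_sym (igs_edge_range e)) _.
  exact: has_normal_form_mul.
- apply: has_normal_form_eq (igs_sym (igs_edgeV_source e)) _.
  exact: has_normal_form_mul.
Qed.

(** A normal form [p q^-1] sends [q] to [p], so it never acts as zero. If two of them act alike,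
    evaluating each at the base point of the other shows that [q] and [q'] are prefixes of each
    other; hence the tails are empty and the words coincide. *)
Lemma act_faithful a b :
  (forall x y, act a x y <-> act b x y) -> igs_eq a b.
Proof.
have act0 c d : igs_eq c (Zero G) -> (forall x y, act c x y <-> act d x y) ->
    igs_eq c d.
  move=> c0 cd; have [d0|[u [w [p [q [v [pv qv dE]]]]]]] := normal_formP d.
    exact: igs_trans c0 (igs_sym d0).
  have : act d (w, q) (u, p).
    apply/(act_igs_eq dE)/(act_normal_form _ _ pv qv).
    by exists [::]; rewrite !cats0.
  by move=> /cd/(act_igs_eq c0).
move=> ab; have [/act0/(_ ab)//|[u [w [p [q [v [pv qv aE]]]]]]] :=
  normal_formP a.
have [b0|[u' [w' [p' [q' [v' [pv' qv' bE]]]]]]] := normal_formP b.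
  by apply/igs_sym/act0 => // x y; split=> /ab.
have aP x y : act a x y <-> exists l, x = (w, q ++ l) /\ y = (u, p ++ l).
  by rewrite (act_igs_eq aE); exact: act_normal_form.
have bP x y : act b x y <-> exists l, x = (w', q' ++ l) /\ y = (u', p' ++ l).
  by rewrite (act_igs_eq bE); exact: act_normal_form.
have /aP/ab/bP[l [[ww' ql] [uu' pl]]] :
    exists l, (w, q) = (w, q ++ l) /\ (u, p) = (u, p ++ l).
  by exists [::]; rewrite !cats0.
have /bP/ab/aP[l' [[_ ql'] _]] :
    exists l, (w', q') = (w', q' ++ l) /\ (u', p') = (u', p' ++ l).
  by exists [::]; rewrite !cats0.
have l0 : l = [::].
  have := congr1 size ql'; rewrite ql !size_cat => /eqP.
  by rewrite -addnA -{1}[size q']addn0 eqn_add2l eq_sym addn_eq0 => /andP[/nilP].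
move: pl ql; rewrite l0 !cats0 => pp' qq'.
(* The middle vertex is recovered as the end of the common walk [p]. *)
rewrite -uu' -pp' in pv'.
have vv' := is_walk_end pv pv'.
apply: igs_trans aE _; rewrite pp' qq' vv'; exact: igs_sym.
Qed.

Lemma act_tree a b x y : act a x y -> act b x y ->
  (forall x' y', act a x' y' -> act b x' y') \/
  (forall x' y', act b x' y' -> act a x' y').
Proof.
have [a0 /(act_igs_eq a0)//|[u [w [p [q [v [pv qv aE]]]]]]] :=
  normal_formP a.
have [b0 _ /(act_igs_eq b0)//|[u' [w' [p' [q' [v' [pv' qv' bE]]]]]]] :=
  normal_formP b.
move=> /(act_igs_eq aE)/(act_normal_form _ _ pv qv)[l [-> ->]].
move=> /(act_igs_eq bE)/(act_normal_form _ _ pv' qv')[l' [[ww ql] [uu pl]]].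
(* The shorter tail belongs to the longer words, hence to the smaller element. *)
have [ll'|/ltnW ll'] := leqP (size l) (size l'); [left|right] => x' y'.
  move=> /(act_igs_eq aE)/(act_normal_form _ _ pv qv)[k [-> ->]].
  apply/(act_igs_eq bE)/(act_normal_form _ _ pv' qv').
  rewrite (cat_eq_prefix ll' ql) (cat_eq_prefix ll' pl) ww uu -!catA.
  by eexists; split.
move=> /(act_igs_eq bE)/(act_normal_form _ _ pv' qv')[k [-> ->]].
apply/(act_igs_eq aE)/(act_normal_form _ _ pv qv).
rewrite (cat_eq_prefix ll' (esym ql)) (cat_eq_prefix ll' (esym pl)) -ww -uu.
by rewrite -!catA; eexists; split.
Qed.

End Action.

(** * Natural order and orthogonality in terms of the action *)

Section NaturalOrder.
Variable G : digraph.
Implicit Types f g h : igs G.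

Definition igs_act f := act (igs_repr f).

Lemma igs_act_class (t : igs_term G) x y :
  igs_act (igs_class t) x y <-> act t x y.
Proof. exact/act_igs_eq/igs_classP/igs_reprK. Qed.

Lemma igs_act_mul f g x y :
  igs_act (mul f g) x y <-> exists2 z, igs_act g x z & igs_act f z y.
Proof. exact: igs_act_class. Qed.

Lemma igs_act_inj f g :
  (forall x y, igs_act f x y <-> igs_act g x y) -> f = g.
Proof.
by move=> fg; rewrite -[f]igs_reprK -[g]igs_reprK; exact/igs_classP/act_faithful.
Qed.

Lemma igs_act0 x y : ~ igs_act (szero : igs G) x y.
Proof. by move=> /igs_act_class. Qed.

Lemma igs_neq0P f : f <> szero <-> exists x y, igs_act f x y.
Proof.
split=> [f0|[x [y fxy]] f0]; last by rewrite f0 in fxy; exact: igs_act0 fxy.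
apply: contrapT => nf; apply/f0/igs_act_inj => x y.
by split=> [fxy|/igs_act0//]; case: nf; exists x, y.
Qed.

Lemma natural_leP f g :
  natural_le f g <-> (forall x y, igs_act f x y -> igs_act g x y).
Proof.
split=> [[e ee ->] x y /igs_act_mul[z gz ez]|fg].
  (* Idempotents act as partial identities: if [e] sends [z] to [y], then [e e = e] makes it fix
     [y], and injectivity gives [z = y]. *)
  have /igs_act_mul[z' ez' ez'y] : igs_act (mul e e) z y by rewrite ee.
  rewrite (act_functional ez' ez) in ez'y.
  by rewrite -(act_injective ez ez'y).
(* The idempotent is [f f^-1], the identity on the image of [f]. *)
pose t := igs_repr f; pose e := igs_class (Mul t (term_inv t)).
have eP x y : igs_act e x y <-> x = y /\ exists z, igs_act f z x.
  rewrite igs_act_class; split=> [[z /act_inv zx zy]|[<- [z zx]]].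
    by split; [exact: act_functional zx zy | exists z].
  by exists z => //; exact/act_inv.
exists e.
  apply: igs_act_inj => x y; rewrite igs_act_mul; split.
    by move=> [z /eP[-> _]].
  by move=> /[dup] exy /eP[xy _]; exists x; rewrite // {2}xy.
apply: igs_act_inj => x y; rewrite igs_act_mul; split=> [fxy|].
  by exists y; [exact: fg | apply/eP; split=> //; exists x].
move=> [z gxz /eP[<- [x' fx']]].
by rewrite (act_injective gxz (fg _ _ fx')).
Qed.

(** If the actions share a point, [act_tree] makes [f] or [g] itself a non-zero common lower bound;
    conversely, a non-zero lower bound acts somewhere, and both actions extend it there. *)
Lemma omega_eq0P f g :
  omega f g = [set szero]%classic <->
  ~ exists x y, igs_act f x y /\ igs_act g x y.
Proof.
split=> [fg0 [x [y [fxy gxy]]]|fg0].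
  have le_refl h : natural_le h h by exact/natural_leP.
  have : omega f g f \/ omega f g g.
    have [fg|gf] := act_tree fxy gxy; [left|right]; split=> //.
      exact/natural_leP.
    exact/natural_leP.
  rewrite fg0 => -[/= f0|/= g0].
    by rewrite f0 in fxy; exact: igs_act0 fxy.
  by rewrite g0 in gxy; exact: igs_act0 gxy.
apply/seteqP; split=> [h [/natural_leP hf /natural_leP hg]|h -> /=].
  apply: contrapT => /igs_neq0P[x [y hxy]]; apply: fg0.
  by exists x, y; split; [exact: hf | exact: hg].
by split; apply/natural_leP => x y /igs_act0.
Qed.

Lemma omega_neq0_comparable f g : omega f g <> [set szero]%classic ->
  natural_le f g \/ natural_le g f.
Proof.
move=> fg; have [x [y [fxy gxy]]] :
    exists x y, igs_act f x y /\ igs_act g x y.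
  by apply: contrapT => /omega_eq0P.
by have [?|?] := act_tree fxy gxy; [left|right]; exact/natural_leP.
Qed.

Lemma omega_eq0_le f g h : natural_le f g ->
  omega g h = [set szero]%classic -> omega f h = [set szero]%classic.
Proof.
move=> /natural_leP fg /omega_eq0P gh; apply/omega_eq0P => -[x [y [fxy hxy]]].
by apply: gh; exists x, y; split=> //; exact: fg.
Qed.

Lemma omega_eq0_neq f g :
  f <> szero -> omega f g = [set szero]%classic -> f <> g.
Proof.
move=> /igs_neq0P[x [y fxy]] /omega_eq0P fg fEg.
by apply: fg; exists x, y; rewrite -fEg.
Qed.

Lemma exists_orthogonal_pair : ~ trivial_digraph G ->
  exists f g, [/\ f <> szero, g <> szero & omega f g = [set szero]%classic].
Proof.
move=> nontriv; have [v0] := vertex_inhabited G.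
have [[e]|noE] := pselect (inhabited (edge G)).
  exists (igs_class (Edge e)), (igs_class (Vert (source e))); split.
  - apply/igs_neq0P; exists (range e, [::]), (source e, [:: e]).
    exact/igs_act_class.
  - apply/igs_neq0P; exists (source e, [::]), (source e, [::]).
    exact/igs_act_class.
  (* An edge lengthens the list by one, while a vertex leaves it unchanged. *)
  - apply/omega_eq0P => -[x [y [/igs_act_class/= [_ ->]]]].
    move=> /igs_act_class/= [_] /(congr1 (size \o snd))/= /eqP.
    by rewrite -[X in _ == X]add0n -add1n eqn_add2r.
have [u uv0] : exists u, u <> v0.
  apply: contrapT => allv0; apply: nontriv; split=> [|e]; last first.
    by apply: noE; constructor.
  by exists v0 => u; apply: contrapT => uv0; apply: allv0; exists u.
exists (igs_class (Vert u)), (igs_class (Vert v0)); split.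
- by apply/igs_neq0P; exists (u, [::]), (u, [::]); exact/igs_act_class.
- by apply/igs_neq0P; exists (v0, [::]), (v0, [::]); exact/igs_act_class.
- apply/omega_eq0P => -[x [y [/igs_act_class/= [xu _]]]].
  by move=> /igs_act_class/= [xv _]; apply: uv0; rewrite -xu.
Qed.

End NaturalOrder.

Theorem theorem5p7 (G : digraph) (hG : ~ trivial_digraph G) :
  exists2 d : nat, d = 1 \/ d = 2
    & is_diam (zero_divisor_graph (igs G)) (Some d).
Proof.
have zdivP (f g : igs G) : f <> szero -> g <> szero ->
    omega f g = [set szero]%classic -> f \in @zero_divisors (igs G).
  by move=> f0 g0 fg; apply/mem_set; split=> //; exists g.
apply: diam_common_neighbour => [|x y xy nadj].
  have [f [g [f0 g0 fg]]] := exists_orthogonal_pair hG.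
  have gf : omega g f = [set szero]%classic by rewrite omegaC.
  exists (exist _ f (zdivP _ _ f0 g0 fg)), (exist _ g (zdivP _ _ g0 f0 gf)).
  by move=> /(congr1 val)/=; exact: omega_eq0_neq f0 fg.
have nxy : omega (val x) (val y) <> [set szero]%classic.
  by move=> oxy; move/asboolP: nadj; apply.
have neighbour (a b : node (zero_divisor_graph (igs G))) :
    natural_le (val a) (val b) -> exists2 c, adj a c & adj c b.
  move=> ab; have [b0 [h [h0 bh]]] := set_mem (valP b).
  have [a0 _] := set_mem (valP a).
  have hb : omega h (val b) = [set szero]%classic by rewrite omegaC.
  have ah := omega_eq0_le ab bh.
  (* Orthogonality is symmetric, so [val b] witnesses that [h] is itself a vertex of the graph. *)
  exists (exist _ h (zdivP _ _ h0 b0 hb)); apply/asboolP; split=> //.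
    by move=> /(congr1 val)/=; exact: omega_eq0_neq ah.
  by move=> /(congr1 val)/=; exact: omega_eq0_neq hb.
have [/neighbour//|/neighbour[c yc cx]] := omega_neq0_comparable nxy.
by exists c; rewrite adj_sym.
Qed.
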